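(* For every constant $0<\alpha\le 1$ there exists an integer $d_0\ge1$ such that the following holds for all $d\ge d_0$. Let $G$ be a bipartite graph with maximum degree $d$ and minimum degree at least $\alpha d$, and let $f(v)=\deg(v)-\left\lfloor \frac{\alpha}{1000}\sqrt{d\log d}\right\rfloor$ for each $v\in V(G)$. Then $G$ is $f$-removable.
   Context: All graphs are finite and simple; $\log$ is the natural logarithm. For a graph $G$, a function $f:V(G)\to\mathbb Z$, a vertex $u$ and $W\subseteq N(u)$, $\mathsf{DelSave}(G,f,u,W)$ outputs $G'=G-u$ and $f'$ with $f'(x)=f(x)-1$ for $x\in N(u)\setminus W$ and $f'(x)=f(x)$ otherwise; it is legal if $f(u)>\sum_{w\in W}f(w)$ and $f'(x)\ge1$ for all $x\in V(G')$. $G$ is $f$-removable if all vertices of $G$ can be deleted by successive legal $\mathsf{DelSave}$ applications, each time replacing $(G,f)$ by the output $(G',f')$. *)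

(* Defs.v *)
From HB Require Import structures.
From mathcomp Require Import all_boot all_order all_algebra.
From mathcomp Require Import reals exp.
Set Implicit Arguments. Unset Strict Implicit. Unset Printing Implicit Defensive.
Import Order.TTheory GRing.Theory Num.Theory.

(* A finite simple graph on vertex type T is a symmetric irreflexive
   relation e : rel T; its vertex set is all of T. *)
Definition simple_graph (T : finType) (e : rel T) : Prop :=
  symmetric e /\ irreflexive e.

Definition deg (T : finType) (e : rel T) (v : T) : nat := #|[set y | e v y]|.

Definition bipartite (T : finType) (e : rel T) : Prop :=
  exists A : {set T}, forall x y, e x y -> (x \in A) != (y \in A).

Definition max_degree (T : finType) (e : rel T) (d : nat) : Prop :=
  (forall v, deg e v <= d)%N /\ exists v, deg e v = d.

(* Current graph during the process: the subgraph of (T,e) induced on S. *)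
Definition nbhd (T : finType) (e : rel T) (S : {set T}) (u : T) : {set T} :=
  [set x in S | e u x].

Definition delsave_f (T : finType) (e : rel T) (S : {set T})
    (f : T -> int) (u : T) (W : {set T}) : T -> int :=
  fun x => if (x \in nbhd e S u) && (x \notin W) then (f x - 1)%R else f x.

Definition delsave_legal (T : finType) (e : rel T) (S : {set T})
    (f : T -> int) (u : T) (W : {set T}) : Prop :=
  [/\ u \in S, W \subset nbhd e S u,
      (\sum_(w in W) f w < f u)%R &
      forall x, x \in S :\ u -> (1 <= delsave_f e S f u W x)%R].

Inductive removable (T : finType) (e : rel T) : {set T} -> (T -> int) -> Prop :=
  | removable_nil f : removable e set0 f
  | removable_step S f u W :
      delsave_legal e S f u W ->
      removable e (S :\ u) (delsave_f e S f u W) ->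
      removable e S f.

Definition f_removable (T : finType) (e : rel T) (f : T -> int) : Prop :=
  removable e [set: T] f.

(* Main.v *)
(* Let A, B be the two sides.  Give every vertex an independent label in
   {0, ..., m}, equal to i with probability about 2^-i, where 2^m has order
   sqrt(d / log d); let A' and L be the vertices of A and B with label m.  Delete
   A \ A' label by label, then B \ L, then A', then L.  Every vertex has more
   than k = floor(alpha / 1000 * sqrt(d log d)) neighbours in A' or in L, so only
   the vertices of L have to be saved, and k + 1 saves are enough for each.  When
   label i is being deleted, a vertex of L has value O(2^-i d), so a vertex of A
   can save order 2^i of its O(2^-m d) neighbours in L.  If these are chosen at
   random, a vertex of L expects order alpha 2^m saves for each label, hence order
   alpha 2^m log d >= k + 1 saves in total.  All counts are concentrated by
   Chernoff bounds, and the local lemma handles all vertices simultaneously. *)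
Require Import Defs.
From HB Require Import structures.
From mathcomp Require Import all_boot all_order all_algebra.
From mathcomp Require Import reals sequences exp.
From mathcomp Require Import ring lra zify.
Set Implicit Arguments. Unset Strict Implicit. Unset Printing Implicit Defensive.
Import Order.TTheory GRing.Theory Num.Theory.

Local Open Scope ring_scope.

(** * Product measures and the local lemma *)

Section ProductMeasure.

Variables (R : realType) (I K : finType) (w : I -> K -> R).
Hypothesis w_ge0 : forall x c, 0 <= w x c.
Hypothesis w_sum1 : forall x, \sum_c w x c = 1.

Implicit Types (f g : {ffun I -> K}) (E G : pred {ffun I -> K}).

Definition weight f : R := \prod_x w x (f x).

Definition Pr E : R := \sum_f (E f)%:R * weight f.

Definition depends_on E (D : {set I}) :=
  forall f g, {in D, f =1 g} -> E f = E g.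

Lemma weight_ge0 f : 0 <= weight f.
Proof. by apply: prodr_ge0. Qed.

Lemma expectation_prod (g : I -> K -> R) :
  \sum_f weight f * \prod_x g x (f x) = \prod_x \sum_c w x c * g x c.
Proof.
by rewrite bigA_distr_bigA; apply: eq_bigr => f _; rewrite -big_split.
Qed.

Lemma sum_weight : \sum_f weight f = 1.
Proof. by rewrite -bigA_distr_bigA big1 // => x _; rewrite w_sum1. Qed.

Lemma Pr_ge0 E : 0 <= Pr E.
Proof. by apply: sumr_ge0 => f _; rewrite mulr_ge0 ?weight_ge0. Qed.

Lemma Pr_le E G : (forall f, E f -> G f) -> Pr E <= Pr G.
Proof.
move=> sEG; apply: ler_sum => f _; rewrite ler_wpM2r ?weight_ge0 // ler_nat.
by case: (E f) (sEG f) => // ->.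
Qed.

Lemma Pr_markov E (h : {ffun I -> K} -> R) :
    (forall f, 0 <= h f) -> (forall f, E f -> 1 <= h f) ->
  Pr E <= \sum_f weight f * h f.
Proof.
move=> h0 h1; apply: ler_sum => f _; rewrite mulrC ler_wpM2l ?weight_ge0 //.
by case: (boolP (E f)) => [/h1|].
Qed.

(* Exchanging the coordinates in D between two independent samples preserves
   the product of their weights. *)
Lemma Pr_indep E G D : depends_on E D -> depends_on G (~: D) ->
  Pr (predI E G) = Pr E * Pr G.
Proof.
move=> depE depG.
rewrite -[LHS]mulr1 -sum_weight [LHS]big_distrlr [RHS]big_distrlr /=.
rewrite !pair_bigA /=.
pose mix f g : {ffun I -> K} := [ffun x => if x \in D then f x else g x].
pose s (p : {ffun I -> K} * {ffun I -> K}) := (mix p.1 p.2, mix p.2 p.1).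
have sK : involutive s.
  case=> f g; rewrite /s /=; congr (_, _); apply/ffunP=> x;
    by rewrite !ffunE /=; case: (x \in D).
rewrite [RHS](reindex_inj (inv_inj sK)) /=; apply: eq_bigr => -[f g] _ /=.
have -> : E (mix f g) = E f by apply: depE => x xD; rewrite ffunE xD.
have -> : G (mix g f) = G f.
  by apply: depG => x; rewrite inE ffunE => /negPf ->.
have mixM : weight f * weight g = weight (mix f g) * weight (mix g f).
  rewrite /weight -!big_split; apply: eq_bigr => x _ /=; rewrite !ffunE.
  by case: ifP => // _; rewrite mulrC.
by rewrite -mulnb natrM -mulrA mixM; ring.
Qed.

Section LocalLemma.

Variables (J : finType) (E : J -> pred {ffun I -> K}) (D : J -> {set I}) (n : nat).
Hypothesis n_gt0 : (0 < n)%N.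
Hypothesis depE : forall j, depends_on (E j) (D j).
Hypothesis degE : forall j, (#|[set j' | ~~ [disjoint D j & D j']]| <= n)%N.
Hypothesis PrE : forall j, (4 * n)%:R * Pr (E j) <= 1.

Let avoid (S : {set J}) f := [forall j in S, ~~ E j f].

Let avoid_split (S1 S2 : {set J}) :
  Pr (avoid S2) <=
    Pr (avoid (S1 :|: S2)) + \sum_(j in S1) Pr (predI (E j) (avoid S2)).
Proof.
rewrite exchange_big /= -big_split /=; apply: ler_sum => f _.
rewrite -mulr_suml -mulrDl ler_wpM2r ?weight_ge0 // -natr_sum -natrD ler_nat.
case: (boolP (avoid S2 f)) => // av2.
case: (boolP (avoid (S1 :|: S2) f)) => [|/forall_inPn[j]]; first by rewrite leq_addr.
rewrite negbK inE => /orP[jS1 Ej|jS2 Ej]; last by have /forall_inP/(_ j jS2)/negP := av2.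
by rewrite add0n (bigD1 j) //= Ej.
Qed.

Let avoid_cond (S : {set J}) :
  0 < Pr (avoid S) /\
  forall i, (2 * n)%:R * Pr (predI (E i) (avoid S)) <= Pr (avoid S).
Proof.
have n0 : 0 < n%:R :> R by rewrite ltr0n.
have [b] := ubnP #|S|; elim: b S => // b IH S; rewrite ltnS => leSb.
have pos : 0 < Pr (avoid S).
  have [->|[j jS]] := set_0Vmem S.
    rewrite (_ : Pr _ = 1) // -sum_weight; apply: eq_bigr => f _.
    by rewrite (_ : avoid _ _ = true) ?mul1r //; apply/forall_inP => j; rewrite inE.
  have /IH[pos' /(_ j) lej] : (#|S :\ j| < b)%N.
    by move: leSb; rewrite (cardsD1 j S) jS.
  have := avoid_split [set j] (S :\ j); rewrite setD1K // big_set1.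
  rewrite natrM in lej; set a := Pr (predI _ _) in lej *.
  have : 1 <= n%:R :> R by rewrite (ler_nat _ 1%N).
  have : 0 <= a by exact: Pr_ge0.
  nra.
split=> // i; pose N := [set j' | ~~ [disjoint D i & D j']].
pose S1 := S :&: N; pose S2 := S :\: N.
have eqS : S1 :|: S2 = S by rewrite setID.
have indep : Pr (predI (E i) (avoid S2)) = Pr (E i) * Pr (avoid S2).
  apply: Pr_indep (depE (j := i)) _ => f g eqfg; apply: eq_forallb_in => j.
  rewrite !inE negbK => /andP[dij _]; congr (~~ _); apply: depE => x xj.
  by apply: eqfg; rewrite inE; apply: contraL xj => xi; rewrite (disjointFr dij).
have half : Pr (avoid S2) <= 2 * Pr (avoid S).
  have := avoid_split S1 S2; rewrite eqS.
  have : (2 * n)%:R * \sum_(j in S1) Pr (predI (E j) (avoid S2))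
      <= n%:R * Pr (avoid S2).
    rewrite mulr_sumr; apply: (@le_trans _ _ (\sum_(j in S1) Pr (avoid S2))).
      apply: ler_sum => j jS1; have [] // := IH S2; apply: leq_trans leSb.
      apply: proper_card; rewrite properEneq subsetDl andbT.
      apply: contraTneq jS1 => eqS2; rewrite in_setI -{1}eqS2 in_setD.
      by case: (j \in N); rewrite ?andbF.
    rewrite sumr_const -[leLHS]mulr_natl ler_wpM2r //.
      exact: Pr_ge0.
    by rewrite ler_nat (leq_trans _ (degE i)) // subset_leq_card ?subsetIr.
  rewrite natrM; set s := \sum_(j in S1) _; nra.
have le2 : Pr (predI (E i) (avoid S)) <= Pr (predI (E i) (avoid S2)).
  apply: Pr_le => f /= /andP[-> /forall_inP av]; apply/forall_inP => j.
  by rewrite inE => /andP[_ /av].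
rewrite indep in le2; have := PrE i; rewrite !natrM => PrEi.
have := Pr_ge0 (avoid S2); set q := Pr (avoid S2) in half le2 *.
set p := Pr (E i) in PrEi le2; have := ler_wpM2l (ltW n0) le2; nra.
Qed.

Lemma local_lemma : exists f, forall j, ~~ E j f.
Proof.
have [pos _] := avoid_cond setT.
have [f /forall_inP av|noav] := pickP (avoid setT).
  by exists f => j; apply: av.
by move: pos; rewrite /Pr big1 ?ltxx // => f _; rewrite noav mul0r.
Qed.

End LocalLemma.

(** * Chernoff bounds *)

Section Chernoff.

Variables (D : {set I}) (Q : I -> pred K).

Definition hits f : nat := #|[set x in D | Q x (f x)]|.

Definition mean : R := \sum_(x in D) \sum_(c | Q x c) w x c.

Lemma mgf_le (t : R) : 0 <= t ->
  \sum_f weight f * t ^+ hits f <= expR ((t - 1) * mean).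
Proof.
move=> t0; pose g x c := if (x \in D) && Q x c then t else 1.
rewrite (eq_bigr (fun f => weight f * \prod_x g x (f x))) => [|f _]; last first.
  congr (_ * _); rewrite /hits -big_mkcond /= -prodr_const.
  by apply: eq_bigl => x; rewrite inE.
rewrite expectation_prod /mean mulr_sumr expR_sum [leRHS]big_mkcond /=.
apply: ler_prod => x _; rewrite sumr_ge0 /= => [|c _]; last first.
  by rewrite mulr_ge0 // /g; case: ifP.
rewrite /g; case: ifP => xD /=; last first.
  by rewrite (eq_bigr (w x)) ?w_sum1 // => c _; rewrite mulr1.
apply: le_trans (expR_ge1Dx _).
rewrite mulr_sumr [X in _ <= _ + X]big_mkcond -[X in _ <= X + _](w_sum1 x) -big_split /=.
by apply: ler_sum => c _; case: ifP => _; lra.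
Qed.

Lemma expR1_le4 : expR 1 <= 4 :> R.
Proof.
have := expR_ge1Dx (- (1 / 2) : R); rewrite expRN.
have e0 := expR_gt0 (1 / 2 : R); have := divff (lt0r_neq0 e0).
have -> : expR 1 = expR (1/2) * expR (1/2) :> R by rewrite -expRD; congr expR; lra.
set u := expR _ in e0 *; set v := u^-1; nra.
Qed.

Lemma expRN1_le_half : expR (- 1) <= 1 / 2 :> R.
Proof.
rewrite expRN; have := expR_ge1Dx (1 : R); have e0 := expR_gt0 (1 : R).
by have := divff (lt0r_neq0 e0); set u := expR _ in e0 *; set v := u^-1; nra.
Qed.

Lemma chernoff_upper M : 0 <= M -> mean <= M ->
  Pr (fun f => 4 * M < (hits f)%:R) <= expR (- M / 4).
Proof.
move=> M0 le_mean.
apply: le_trans (_ : _ <= expR (-(4 * M)) * expR ((expR 1 - 1) * mean)) _.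
  apply: le_trans (ler_wpM2l (expR_ge0 _) (mgf_le (expR_ge0 _))).
  rewrite mulr_sumr; under [leRHS]eq_bigr => f _ do rewrite mulrCA.
  apply: Pr_markov => f; first by rewrite mulr_ge0 ?exprn_ge0 ?expR_ge0.
  rewrite -expRM_natl -expRD -[X in X <= _]expR0 ler_expR; lra.
have e4 := expR1_le4; have e2 := expR_ge1Dx (1 : R).
rewrite -expRD ler_expR.
have : (expR 1 - 1) * mean <= (expR 1 - 1) * M by rewrite ler_wpM2l //; lra.
have : expR 1 * M <= 4 * M by rewrite ler_wpM2r.
lra.
Qed.

Lemma chernoff_lower M : 0 <= M -> M <= mean ->
  Pr (fun f => (hits f)%:R < M / 4) <= expR (- M / 4).
Proof.
move=> M0 le_mean.
apply: le_trans (_ : _ <= expR (M / 4) * expR ((expR (-1) - 1) * mean)) _.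
  apply: le_trans (ler_wpM2l (expR_ge0 _) (mgf_le (expR_ge0 _))).
  rewrite mulr_sumr; under [leRHS]eq_bigr => f _ do rewrite mulrCA.
  apply: Pr_markov => f; first by rewrite mulr_ge0 ?exprn_ge0 ?expR_ge0.
  rewrite -expRM_natl -expRD -[X in X <= _]expR0 ler_expR; lra.
have e2 := expRN1_le_half.
rewrite -expRD ler_expR.
have : (expR (-1) - 1) * mean <= (expR (-1) - 1) * M by rewrite ler_wnM2l //; lra.
have : expR (-1) * M <= 1 / 2 * M by rewrite ler_wpM2r.
lra.
Qed.

End Chernoff.

(* Each j fails with probability at most 2 exp(- M j / 4) <= 1 / (4 n), as the
   local lemma requires. *)
Lemma splitting (J : finType) (D : J -> {set I}) (Q : J -> I -> pred K)
    (M : J -> R) (n : nat) :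
    (0 < n)%N ->
    (forall j, (#|[set j' | ~~ [disjoint D j & D j']]| <= n)%N) ->
    (forall j, 0 <= M j) ->
    (forall j, (8 * n)%:R <= expR (M j / 4)) ->
  exists f, forall j,
    (mean (D j) (Q j) <= M j -> (hits (D j) (Q j) f)%:R <= 4 * M j) /\
    (M j <= mean (D j) (Q j) -> M j / 4 <= (hits (D j) (Q j) f)%:R).
Proof.
move=> n_gt0 degD M0 largeM.
pose up j f := (mean (D j) (Q j) <= M j) && (4 * M j < (hits (D j) (Q j) f)%:R).
pose lo j f := (M j <= mean (D j) (Q j)) && ((hits (D j) (Q j) f)%:R < M j / 4).
have [|j|f good] := @local_lemma J (fun j => predU (up j) (lo j)) D n n_gt0 _ degD.
- move=> j f g eqfg /=.
  have eqh : hits (D j) (Q j) f = hits (D j) (Q j) g.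
    apply: eq_card => x; rewrite !inE; case: (boolP (x \in D j)) => //= xD.
    by rewrite eqfg.
  by rewrite /up /lo eqh.
- have Pup : Pr (up j) <= expR (- M j / 4).
    have [le|gt] := leP (mean (D j) (Q j)) (M j).
      apply: le_trans (chernoff_upper (M0 j) le).
      by apply: Pr_le => f /andP[].
    apply: le_trans (expR_ge0 _); rewrite /Pr big1 // => f _.
    by rewrite /up leNgt gt mul0r.
  have Plo : Pr (lo j) <= expR (- M j / 4).
    have [le|gt] := leP (M j) (mean (D j) (Q j)).
      apply: le_trans (chernoff_lower (M0 j) le).
      by apply: Pr_le => f /andP[].
    apply: le_trans (expR_ge0 _); rewrite /Pr big1 // => f _.
    by rewrite /lo leNgt gt mul0r.
  have : Pr (predU (up j) (lo j)) <= Pr (up j) + Pr (lo j).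
    rewrite -big_split; apply: ler_sum => f _ /=; rewrite -mulrDl.
    by rewrite ler_wpM2r ?weight_ge0 // -natrD ler_nat; case: (up j f); case: (lo j f).
  rewrite mulNr expRN in Pup Plo; have e0 := expR_gt0 (M j / 4).
  have := largeM j; rewrite -(@ler_pM2r _ (expR (M j / 4))^-1) ?invr_gt0 //.
  rewrite divff ?gt_eqF // !natrM => le1 Pu.
  have n0 : 0 < n%:R :> R by rewrite ltr0n.
  set u := _^-1 in Pup Plo le1; nra.
exists f => j; have := good j; rewrite negb_or !negb_and.
case/andP=> /orP[/negPf Hu|Hu] /orP[/negPf Hl|Hl]; split; rewrite ?Hu ?Hl // => _;
  by rewrite leNgt.
Qed.

End ProductMeasure.

(** * Deletion by increasing rank *)

Section RankedRemoval.

Variables (T : finType) (e : rel T) (k : nat) (rk : T -> nat) (P : T -> {set T}).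

Let later x := [set y | e x y && (rk x < rk y)%N].
Let not_before w r := [set y | e w y && (r <= rk y)%N].

Hypothesis e_sym : symmetric e.
Hypothesis P_nbr : forall x, P x \subset [set y | e x y].
Hypothesis P_card : forall x, (#|P x| <= k.+1)%N.
Hypothesis surplus : forall x, (k < #|later x :|: P x|)%N.
Hypothesis budget : forall u, (exists w, u \in P w) ->
  (\sum_(w | u \in P w) #|not_before w (rk u)|.+1 + k < #|later u|)%N.

(* The value of x when S is what remains, if x is saved exactly at the deletion
   of the vertices of P x. *)
Let value (S : {set T}) x : int :=
  (#|nbhd e S x| + #|P x :\: S|)%N%:Z - k%:Z.

Let up_closed (S : {set T}) := forall x y, x \in S -> y \notin S -> (rk y <= rk x)%N.

Let later_sub (S : {set T}) x : up_closed S -> x \in S -> later x \subset nbhd e S x.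
Proof.
move=> clS xS; apply/subsetP => y; rewrite !inE => /andP[exy lt_xy].
rewrite exy andbT; apply: contraLR lt_xy => yS.
by rewrite -leqNgt (clS x y xS yS).
Qed.

Let value_ge1 (S : {set T}) x : up_closed S -> x \in S -> 1 <= value S x.
Proof.
move=> clS xS; suff : (k < #|nbhd e S x| + #|P x :\: S|)%N by rewrite /value; lia.
apply: leq_trans (surplus x) _; apply: leq_trans (leq_card_setU _ _).
apply: subset_leq_card; apply/subsetP => y; rewrite in_setU => /orP[yl|yP].
  by rewrite in_setU (subsetP (later_sub clS xS) _ yl).
have := subsetP (P_nbr x) _ yP; rewrite !inE => ->; rewrite yP andbT.
by case: (y \in S).
Qed.

Let value_step (S : {set T}) u x : u \in S -> x \in S :\ u ->
  delsave_f e S (value S) u [set w in S | u \in P w] x = value (S :\ u) x.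
Proof.
move=> uS /setD1P[xNu xS]; rewrite /delsave_f !inE xS /= e_sym /value.
have sub_nbhd : nbhd e (S :\ u) x = nbhd e S x :\ u.
  by apply/setP => y; rewrite !inE andbA.
have card_nbhd : #|nbhd e S x| = (e x u + #|nbhd e (S :\ u) x|)%N.
  by rewrite (cardsD1 u) sub_nbhd !inE uS.
have card_P : #|P x :\: (S :\ u)| = ((u \in P x) + #|P x :\: S|)%N.
  rewrite (cardsD1 u) !inE eqxx /=; congr (_ + #|pred_of_set _|)%N.
  apply/setP => y; rewrite !inE; case: eqVneq => //= ->.
  by rewrite uS.
have uPe : u \in P x -> e x u by move/(subsetP (P_nbr x)); rewrite inE.
rewrite card_nbhd card_P; case: (u \in P x) uPe => [->//|_] /=; first by lia.
by case: (e x u) => /=; lia.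
Qed.

Let value_upper (S : {set T}) u w : (forall y, y \in S -> (rk u <= rk y)%N) ->
  value S w <= #|not_before w (rk u)|.+1%:Z.
Proof.
move=> min_u; have : (#|nbhd e S w| <= #|not_before w (rk u)|)%N.
  by apply/subset_leq_card/subsetP => y; rewrite !inE => /andP[/min_u-> ->].
have : (#|P w :\: S| <= k.+1)%N.
  exact: leq_trans (subset_leq_card (subsetDl _ _)) (P_card w).
by rewrite /value; lia.
Qed.

Let removable_of_value (S : {set T}) f : up_closed S -> {in S, f =1 value S} ->
  removable e S f.
Proof.
have [n] := ubnP #|S|; elim: n S f => // n IH S f; rewrite ltnS => leSn clS fE.
have [->|[u0 u0S]] := set_0Vmem S; first exact: removable_nil.
case: (arg_minnP rk u0S) => u uS min_u; have {}uS : u \in S := uS.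
pose W := [set w in S | u \in P w].
have clS' : up_closed (S :\ u).
  move=> x y /setD1P[_ xS]; rewrite in_setD1 negb_and negbK.
  by case/orP=> [/eqP->|/(clS _ _ xS)//]; apply: min_u.
have f'E x : x \in S :\ u -> delsave_f e S f u W x = value (S :\ u) x.
  move=> xS'; rewrite -value_step // /delsave_f fE //.
  by case/setD1P: xS'.
apply: (@removable_step _ _ _ _ u W); last first.
  by apply: IH => //; rewrite (cardsD1 u) uS in leSn.
split=> //.
- apply/subsetP => w; rewrite !inE => /andP[-> /(subsetP (P_nbr w))].
  by rewrite inE e_sym.
- rewrite fE //; have [W0|[w wW]] := set_0Vmem W.
    by rewrite W0 big_set0 (lt_le_trans _ (value_ge1 clS uS)).
  have /budget : exists w, u \in P w by exists w; move: wW; rewrite inE => /andP[].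
  have later_le := subset_leq_card (later_sub clS uS).
  set s := (\sum_(w | _) _)%N => lt_s.
  have : \sum_(w in W) f w <= s%:Z.
    rewrite -natz natr_sum big_mkcond [leRHS]big_mkcond.
    apply: ler_sum => y _; rewrite inE; case: ifP => [/andP[yS ->]|_].
      by rewrite fE // natz value_upper.
    by case: ifP.
  by rewrite /value; lia.
- by move=> x xS'; rewrite f'E // value_ge1.
Qed.

Lemma ranked_removal : f_removable e (fun v => (deg e v)%:Z - k%:Z).
Proof.
apply: removable_of_value => [x y _|x _]; first by rewrite inE.
rewrite /value setDT cards0 addn0; congr (_%:Z - _).
by apply: eq_card => y; rewrite !inE.
Qed.

End RankedRemoval.

(** * Random choices *)

Section Labelling.

Variables (R : realType) (T : finType) (e : rel T) (d m : nat).
Hypothesis e_sym : symmetric e.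
Hypothesis deg_le : forall v, (deg e v <= d)%N.

Let N v := [set y | e v y].

Let tail (i : nat) : R := if (i <= m)%N then (2 ^+ i)^-1 else 0.

(* Probability of label c: 2^-(c+1) for c < m and 2^-m for c = m. *)
Let geo (c : 'I_m.+1) : R := tail c - tail c.+1.

Let geo_ge (c : 'I_m.+1) : (2 ^+ c.+1)^-1 <= geo c.
Proof.
have i0 : 0 <= (2 ^+ c)^-1 :> R by rewrite invr_ge0 exprn_ge0.
rewrite /geo /tail -ltnS ltn_ord exprS invfM.
by case: ifP => _; lra.
Qed.

Let geo_ge0 c : 0 <= geo c.
Proof. by apply: le_trans (geo_ge c); rewrite invr_ge0 exprn_ge0. Qed.

Let sum_geo (i : 'I_m.+1) : \sum_(c : 'I_m.+1 | (i <= c)%N) geo c = (2 ^+ i)^-1.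
Proof.
rewrite -(big_mkord (fun c : nat => i <= c)%N (fun c : nat => tail c - tail c.+1)).
rewrite -(big_nat_widenl i 0 _ predT) //.
under eq_bigr => c _ do rewrite -opprB.
rewrite sumrN telescope_sumr; last exact: ltnW.
by rewrite /tail ltnn sub0r opprK -ltnS ltn_ord.
Qed.

Lemma labelling :
    (0 < d)%N ->
    (forall v, (8 * (d * d * (m.+1 * 2)))%:R <=
      expR ((deg e v)%:R / 2 ^+ m.+1 / 4 : R)) ->
  exists phi : T -> 'I_m.+1, forall v (i : 'I_m.+1),
    [/\ #|[set y | e v y && (i <= phi y)%N]|%:R <= 4 * ((deg e v)%:R / 2 ^+ i) :> R,
        (deg e v)%:R / 2 ^+ i / 4 <= #|[set y | e v y && (i <= phi y)%N]|%:R :> R &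
        (deg e v)%:R / 2 ^+ i.+1 / 4 <= #|[set y | e v y && (phi y == i)]|%:R :> R].
Proof.
move=> d_gt0 large; pose J := (T * ('I_m.+1 * bool))%type.
pose D (j : J) := N j.1.
pose Q (j : J) (x : T) (c : 'I_m.+1) := if j.2.2 then (j.2.1 <= c)%N else c == j.2.1.
pose M (j : J) : R := (deg e j.1)%:R / 2 ^+ (j.2.1 + ~~ j.2.2).
have degD (j : J) : (#|[set j' | ~~ [disjoint D j & D j']]| <= d * d * (m.+1 * 2))%N.
  apply: (@leq_trans #|setX (\bigcup_(x in N j.1) N x) [set: 'I_m.+1 * bool]|).
    apply/subset_leq_card/subsetP => j'.
    rewrite !inE andbT => /pred0Pn[x /andP[/= xj xj']].
    apply/bigcupP; exists x => //; rewrite inE.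
    by move: xj'; rewrite /D inE e_sym.
  rewrite cardsX cardsT card_prod card_ord card_bool leq_mul2r; apply/orP; right.
  apply: (@leq_trans (\sum_(x in N j.1) d)).
    apply: (big_rec2 (fun (X : {set T}) n => (#|X| <= n)%N)) => [|x n X _ leX].
      by rewrite cards0.
    by rewrite (leq_trans (leq_card_setU _ _)) // leq_add // deg_le.
  by rewrite sum_nat_const leq_mul2r (deg_le j.1) orbT.
have M0 j : 0 <= M j by rewrite /M mulr_ge0 // invr_ge0 exprn_ge0.
have largeM j : (8 * (d * d * (m.+1 * 2)))%:R <= expR (M j / 4).
  apply: le_trans (large j.1) _; rewrite ler_expR ler_pM2r ?invr_gt0 //.
  rewrite ler_wpM2l // lef_pV2 ?posrE ?exprn_gt0 // ler_eXn2l ?ltr1n //.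
  by rewrite addnC (leq_trans (leq_add (leq_b1 _) (leqnn _))) // ltnS -ltnS.
have sum_geo1 (x : T) : \sum_c geo c = 1.
  by rewrite -[1]invr1 -(expr0 2) -(sum_geo ord0).
have [|f hf] := splitting (fun=> geo_ge0) sum_geo1 (D := D) Q _ degD M0 largeM.
  by rewrite !muln_gt0 d_gt0.
exists f => v i.
rewrite -[[set y | _ && (f y == i)]]/[set y | e v y && Q (v, (i, false)) y (f y)].
have meanE b : mean (fun=> geo) (D (v, (i, b))) (Q (v, (i, b))) =
    (deg e v)%:R * \sum_(c | Q (v, (i, b)) v c) geo c.
  by rewrite /mean /Q /= sumr_const mulr_natl.
have hitsE b : hits (D (v, (i, b))) (Q (v, (i, b))) f =
    #|[set y | e v y && Q (v, (i, b)) y (f y)]|.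
  by apply: eq_card => y; rewrite !inE.
have [] := hf (v, (i, true)); have [_] := hf (v, (i, false)).
rewrite !meanE !hitsE /M /= addn0 addn1 sum_geo.
move=> lo_eq /(_ (lexx _)) up /(_ (lexx _)) lo; split=> //.
by apply: lo_eq; rewrite big_pred1_eq ler_wpM2l.
Qed.

End Labelling.

Section Planning.

Variables (R : realType) (T : finType) (e : rel T) (d : nat).
Hypothesis e_sym : symmetric e.
Hypothesis deg_le : forall v, (deg e v <= d)%N.

(* Each edge from a in X to l in L is selected with probability theta a; P l
   collects the selected neighbours of l. *)
Lemma planning (X L : {set T}) (theta Ma : T -> R) (Ml : R) :
    [disjoint X & L] ->
    (forall a, 0 <= theta a <= 1) ->
    (forall l, l \in L -> Ml <= \sum_(a in X | e l a) theta a) ->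
    (forall a, a \in X -> theta a *+ #|[set l in L | e a l]| <= Ma a) ->
    0 <= Ml -> (forall a, a \in X -> 0 <= Ma a) ->
    (8 * d.+1)%:R <= expR (Ml / 4) ->
    (forall a, a \in X -> (8 * d.+1)%:R <= expR (Ma a / 4)) ->
  exists P : T -> {set T},
    [/\ forall l, P l \subset [set a in X | e l a],
        forall l, l \in L -> Ml / 4 <= #|P l|%:R &
        forall a, a \in X -> #|[set l in L | a \in P l]|%:R <= 4 * Ma a].
Proof.
move=> disjXL theta01 leMl leMa Ml0 Ma0 largeMl largeMa.
pose w (p : T * T) (b : bool) : R := if b then theta p.1 else 1 - theta p.1.
pose DX a := (pair a) @: [set l in L | e a l].
pose DL l := (pair^~ l) @: [set a in X | e l a].
pose D v := if v \in X then DX v else if v \in L then DL v else set0.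
pose M v := if v \in X then Ma v else Ml.
have pair1_inj a : injective (pair a : T -> T * T) by move=> x y [].
have pair2_inj l : injective (pair^~ l : T -> T * T) by move=> x y [].
have w_ge0 p b : 0 <= w p b.
  by have /andP[? ?] := theta01 p.1; rewrite /w; case: b; lra.
have w_sum1 p : \sum_b w p b = 1 by rewrite big_bool /w /=; lra.
have D_ends v p : p \in D v ->
    [/\ v \in X, p.1 = v & e v p.2] \/ [/\ v \notin X, p.2 = v & e v p.1].
  rewrite /D; case: ifP => [vX /imsetP[l]|vX].
    by rewrite inE => /andP[_ ?] ->; left.
  case: ifP => [vL /imsetP[a]|]; last by rewrite inE.
  by rewrite inE => /andP[_ ?] ->; right.
have degD v : (#|[set v' | ~~ [disjoint D v & D v']]| <= d.+1)%N.
  apply: (@leq_trans #|v |: [set y | e v y]|).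
    apply/subset_leq_card/subsetP => v'.
    rewrite !inE => /pred0Pn[p /andP[/= /D_ends pv /D_ends pv']].
    case: pv pv' => -[_ pv ev] [] [_ pv' _]; apply/orP.
    - by left; rewrite -pv -pv'.
    - by right; rewrite -pv'.
    - by right; rewrite -pv'.
    - by left; rewrite -pv -pv'.
  rewrite (leq_trans (leq_card_setU _ _)) // cards1 add1n ltnS; exact: deg_le.
have M0 v : 0 <= M v by rewrite /M; case: ifP => // /Ma0.
have largeM v : (8 * d.+1)%:R <= expR (M v / 4) by rewrite /M; case: ifP => // /largeMa.
have [f hf] := splitting w_ge0 w_sum1 (D := D) (fun _ _ => id) (ltn0Sn d) degD M0 largeM.
exists (fun l => [set a in X | e l a && f (a, l)]); split.
- by move=> l; apply/subsetP => a; rewrite !inE => /and3P[-> ->].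
- move=> l lL; have lX : (l \in X) = false by rewrite (disjointFl disjXL).
  have [_] := hf l; rewrite /M /D lX lL /mean big_imset /=;
    last exact: in2W (pair2_inj l).
  under eq_bigr => a _ do rewrite big_mkcond big_bool /= addr0.
  under eq_bigl => a do rewrite inE.
  move=> /(_ (leMl l lL)) /le_trans; apply; rewrite ler_nat -(card_imset _ (pair2_inj l)).
  apply/subset_leq_card/subsetP => p; rewrite inE => /andP[/imsetP[a]].
  rewrite inE => /andP[aX ela] -> fal; apply: imset_f.
  by rewrite inE aX ela.
- move=> a aX; have [+ _] := hf a.
  rewrite /M /D aX /mean big_imset /=; last exact: in2W (pair1_inj a).
  under eq_bigr => l _ do rewrite big_mkcond big_bool /= addr0.
  rewrite sumr_const => /(_ (leMa a aX)); apply: le_trans.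
  rewrite ler_nat -(card_imset _ (pair1_inj a)).
  apply/subset_leq_card/subsetP => p /imsetP[l]; rewrite !inE => /and4P[lL _ ela fal] ->.
  by rewrite fal andbT imset_f // inE lL e_sym.
Qed.

End Planning.

(** * The deletion scheme *)

Lemma subset_of_card (T : finType) (A : {set T}) n :
  (n <= #|A|)%N -> exists2 B : {set T}, B \subset A & #|B| = n.
Proof.
case/card_geqP => s [uniq_s size_s sA]; exists [set x in s].
  by apply/subsetP => x; rewrite inE => /sA.
by rewrite cardsE -size_s; apply/card_uniqP.
Qed.

Section Assembly.

Variables (R : realType) (T : finType) (e : rel T) (alpha : R) (d m i0 k : nat).
Let Ml : R := (m - i0)%:R * (alpha * 2 ^+ m / 1280).

Hypothesis e_sym : symmetric e.
Hypothesis deg_le : forall v, (deg e v <= d)%N.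
Hypothesis deg_ge : forall v, alpha * d%:R <= (deg e v)%:R.
Hypothesis alpha_gt0 : 0 < alpha.
Hypothesis d_gt0 : (0 < d)%N.
Hypothesis large_labelling :
  (8 * (d * d * (m.+1 * 2)))%:R <= expR (alpha * d%:R / 2 ^+ m.+1 / 4).
Hypothesis large_Ml : (8 * d.+1)%:R <= expR (Ml / 4).
Hypothesis large_i0 : (8 * d.+1)%:R <= expR (alpha * 2 ^+ i0 / 40 / 4).
Hypothesis pow_m2 : 2 ^+ m * 2 ^+ m <= 160 * d%:R :> R.
Hypothesis pow_m : 2 ^+ m <= d%:R :> R.
Hypothesis k_Ml : k.+1%:R <= Ml / 4.
Hypothesis k_reserve : k.+1%:R <= alpha * d%:R / 2 ^+ m / 4.
Hypothesis k_half : k%:R < alpha * d%:R / 2.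

Let d0 : 0 < d%:R :> R. Proof. by rewrite ltr0n. Qed.

Let pow0 i : 0 < 2 ^+ i :> R. Proof. exact: exprn_gt0. Qed.

Lemma bipartite_removable (A : {set T}) :
    (forall x y, e x y -> (x \in A) != (y \in A)) ->
  f_removable e (fun v => (deg e v)%:Z - k%:Z).
Proof.
move=> bip.
have large_deg v : (8 * (d * d * (m.+1 * 2)))%:R <=
      expR ((deg e v)%:R / 2 ^+ m.+1 / 4 : R).
  apply: le_trans large_labelling _; rewrite ler_expR ler_pM2r ?invr_gt0 //.
  by rewrite ler_pM2r ?invr_gt0 //.
have [phi phiP] := labelling e_sym deg_le d_gt0 large_deg.
have phi_le v : (phi v <= m)%N by rewrite -ltnS.
pose X := [set a in A | (i0 <= phi a < m)%N].
pose L := [set l | (l \notin A) && (phi l == m :> nat)].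
pose theta v : R := 2 ^+ phi v * 2 ^+ m / (160 * d%:R).
pose Ma a : R := (deg e a)%:R * 2 ^+ phi a / (40 * d%:R).
have theta01 v : 0 <= theta v <= 1.
  apply/andP; split; first by rewrite divr_ge0 // mulr_ge0 // ltW.
  rewrite ler_pdivrMr ?mulr_gt0 // mul1r.
  apply: le_trans pow_m2; rewrite ler_pM2r ?invr_gt0 // ler_weXn2l //; lra.
have disjXL : [disjoint X & L].
  by apply/pred0P => x /=; rewrite !inE; case: (x \in A); rewrite ?andbF.
have card_L a : #|[set l in L | e a l]|%:R <= 4 * ((deg e a)%:R / 2 ^+ m) :> R.
  have [up _ _] := phiP a ord_max; apply: le_trans up.
  rewrite ler_nat; apply/subset_leq_card/subsetP => l; rewrite !inE.
  by case/andP=> /andP[_ /eqP philm] ->; rewrite /= philm.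
have mean_Ml l : l \in L -> Ml <= \sum_(a in X | e l a) theta a.
  rewrite inE => /andP[lA _].
  rewrite (partition_big phi (fun i : 'I_m.+1 => (i0 <= i < m)%N)) /=; last first.
    by move=> a; rewrite !inE => /andP[/andP[]].
  have -> : Ml = \sum_(i < m.+1 | (i0 <= i < m)%N) alpha * 2 ^+ m / 1280.
    rewrite -(big_mkord (fun i : nat => i0 <= i < m)%N (fun=> alpha * 2 ^+ m / 1280)).
    rewrite (eq_bigl (fun i : nat => (i < m)%N && (i0 <= i)%N)); last first.
      by move=> i; rewrite andbC.
    rewrite -(big_nat_widenl i0 0 m.+1 (fun i => i < m)%N) //.
    have /= <- := big_nat_widen i0 m m.+1 predT (fun=> alpha * 2 ^+ m / 1280) (leqnSn m).
    by rewrite sumr_const_nat /Ml mulr_natl.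
  apply: ler_sum => i /andP[le_i lt_i].
  rewrite (eq_bigr (fun=> 2 ^+ i * 2 ^+ m / (160 * d%:R))); last first.
    by move=> a /andP[_ /eqP <-].
  rewrite (eq_bigl (mem [set y | e l y && (phi y == i)])); last first.
    move=> a; rewrite !inE; case ela: (e l a); rewrite ?andbF //=.
    have -> : a \in A by have := bip _ _ ela; rewrite (negPf lA); case: (a \in A).
    by case: eqP => [->|]; rewrite ?andbF // le_i lt_i.
  rewrite sumr_const -[leRHS]mulr_natl; have [_ _ lo] := phiP l i.
  apply: le_trans (ler_wpM2r _ lo); last by rewrite divr_ge0 ?mulr_ge0 ?ltW.
  have -> : (deg e l)%:R / 2 ^+ i.+1 / 4 * (2 ^+ i * 2 ^+ m / (160 * d%:R)) =
      (deg e l)%:R / d%:R * (2 ^+ m / 1280) :> R.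
    have := pow0 i; rewrite exprS; move: (2 ^+ i) (2 ^+ m) => x y x0.
    by field; rewrite !gt_eqF.
  rewrite -mulrA ler_pM2r ?divr_gt0 //.
  by rewrite ler_pdivlMr.
have mean_Ma a : a \in X -> theta a *+ #|[set l in L | e a l]| <= Ma a.
  move=> _; rewrite -mulr_natr.
  have /andP[th0 _] := theta01 a; apply: le_trans (ler_wpM2l th0 (card_L a)) _.
  rewrite /theta /Ma le_eqVlt; apply/orP; left; apply/eqP.
  have := pow0 m; move: (2 ^+ m) (2 ^+ phi a) => x y x0.
  by field; rewrite !gt_eqF.
have Ml_ge0 : 0 <= Ml by rewrite /Ml mulr_ge0 // divr_ge0 // mulr_ge0 // ltW.
have Ma_ge a : a \in X -> alpha * 2 ^+ i0 / 40 <= Ma a.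
  rewrite inE => /and3P[_ le_i _]; apply: (@le_trans _ _ (alpha * 2 ^+ phi a / 40)).
    by rewrite ler_pM2r ?invr_gt0 // ler_pM2l // ler_weXn2l //; lra.
  rewrite /Ma invfM mulrA ler_pdivlMr // mulrAC ler_pM2r ?invr_gt0 //.
  by rewrite mulrAC ler_pM2r.
have Ma_ge0 a : a \in X -> 0 <= Ma a.
  by move=> aX; apply: le_trans (Ma_ge a aX); rewrite divr_ge0 ?mulr_ge0 ?ltW.
have large_Ma a : a \in X -> (8 * d.+1)%:R <= expR (Ma a / 4).
  by move=> aX; apply: le_trans large_i0 _; rewrite ler_expR ler_pM2r ?invr_gt0 // Ma_ge.
have [P0 [P0_sub P0_large P0_small]] := planning e_sym deg_le disjXL theta01 mean_Ml
  mean_Ma Ml_ge0 Ma_ge0 large_Ml large_Ma.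
have P_ex l : exists Pl : {set T},
    if l \in L then Pl \subset P0 l /\ #|Pl| = k.+1 else Pl = set0.
  have [lL|_] := boolP (l \in L); last by exists set0.
  have : (k.+1 <= #|P0 l|)%N by rewrite -(ler_nat R) (le_trans k_Ml) // P0_large.
  by case/subset_of_card => Pl sub card; exists Pl.
have [P PP] := fin_all_exists P_ex.
have P_L w u : u \in P w -> [/\ w \in L, u \in X, e w u & u \in P0 w].
  move=> uw; move: (PP w) uw; case: ifP => [wL [sub _]|_ ->]; last by rewrite inE.
  move=> /(subsetP sub) uP0; have := subsetP (P0_sub w) _ uP0.
  by rewrite inE => /andP[-> ->].
pose rk v := if v \in A then (if (phi v < m)%N then phi v : nat else m.+1)
             else if (phi v < m)%N then m else m.+2.
have k_deg v : (k < deg e v)%N.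
  rewrite -(ltr_nat R); apply: lt_le_trans (deg_ge v); apply: lt_trans k_half _.
  by have := mulr_gt0 alpha_gt0 d0; lra.
have reserve v : (k < #|[set y | e v y && (phi y == m :> nat)]|)%N.
  have [_ lo _] := phiP v ord_max; rewrite -(ler_nat R).
  apply: le_trans k_reserve _.
  apply: le_trans (_ : (deg e v)%:R / 2 ^+ m / 4 <= _).
    by rewrite ler_pM2r ?invr_gt0 // ler_pM2r ?invr_gt0.
  apply: le_trans lo _; rewrite ler_nat; apply/subset_leq_card/subsetP => y.
  by rewrite !inE => /andP[-> /=]; rewrite eqn_leq phi_le.
apply: (@ranked_removal T e k rk P) => //.
- by move=> x; apply/subsetP => y /P_L[_ _ exy _]; rewrite inE.
- by move=> x; move: (PP x); case: ifP => [_ [_ ->]|_ ->]; rewrite ?cards0.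
- move=> x; rewrite /rk; have bipx y : e x y -> (y \in A) = (x \notin A).
    by move/bip; case: (x \in A); case: (y \in A).
  have [lt_x|ge_x] := ltnP (phi x) m; have [xA|xA] := boolP (x \in A).
  + apply: leq_trans (k_deg x) _; apply/subset_leq_card/subsetP => y.
    rewrite !inE => exy; rewrite exy (bipx y exy) xA /=.
    by case: ifP => _; rewrite ?lt_x //= ?(leq_trans lt_x) ?leqW ?leqnn.
  + apply: leq_trans (reserve x) _; apply/subset_leq_card/subsetP => y.
    rewrite !inE => /andP[exy /eqP phiy]; rewrite exy (bipx y exy) xA /=.
    by rewrite phiy ltnn leqnn.
  + apply: leq_trans (reserve x) _; apply/subset_leq_card/subsetP => y.
    rewrite !inE => /andP[exy /eqP phiy]; rewrite exy (bipx y exy) xA /=.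
    by rewrite phiy ltnn leqnn.
  + have xL : x \in L by rewrite inE xA eqn_leq phi_le ge_x.
    move: (PP x); rewrite xL => -[_ <-]; exact/subset_leq_card/subsetUr.
- move=> u [w0 /P_L[_ uX _ _]]; have := uX; rewrite inE => /and3P[uA _ lt_u].
  have rk_u : rk u = phi u by rewrite /rk uA lt_u.
  have -> : #|[set y | e u y && (rk u < rk y)%N]| = deg e u.
    apply: eq_card => y; rewrite !inE; case euy: (e u y) => //=.
    have yA : (y \in A) = false by have := bip _ _ euy; rewrite uA; case: (y \in A).
    by rewrite rk_u /rk yA; case: ifP => _; rewrite ?lt_u // !ltnS ltnW // ltnW.
  rewrite rk_u -(ltr_nat R) natrD natr_sum.
  have bound w : u \in P w ->
      #|[set y | e w y && (phi u <= rk y)%N]|.+1%:R <= 5 * d%:R / 2 ^+ phi u :> R.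
    case/P_L; rewrite inE => /andP[wA _] _ _ _; have [up _ _] := phiP w (phi u).
    have : #|[set y | e w y && (phi u <= rk y)%N]|%:R <=
        4 * ((deg e w)%:R / 2 ^+ phi u) :> R.
      apply: le_trans up; rewrite ler_nat; apply/subset_leq_card/subsetP => y.
      rewrite !inE => /andP[ewy]; rewrite ewy /= /rk.
      have -> : y \in A by have := bip _ _ ewy; rewrite (negPf wA); case: (y \in A).
      case: ltnP => // ge_y _; exact: leq_trans (phi_le u) ge_y.
    have : 1 <= d%:R / 2 ^+ phi u :> R.
      by rewrite ler_pdivlMr // mul1r (le_trans _ pow_m) // ler_weXn2l ?phi_le //; lra.
    have : (deg e w)%:R / 2 ^+ phi u <= d%:R / 2 ^+ phi u :> R.
      by rewrite ler_pM2r ?invr_gt0 // ler_nat.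
    by move=> le1 le2 le3; rewrite -mulrA -[leLHS]natr1; lra.
  have count : #|[set w | u \in P w]|%:R <= 4 * Ma u.
    apply: le_trans (P0_small u uX); rewrite ler_nat.
    apply/subset_leq_card/subsetP => w; rewrite !inE => /P_L[+ _ _ ->].
    by rewrite inE => ->.
  apply: le_lt_trans (_ : (deg e u)%:R / 2 + k%:R < _); last first.
    by have := k_half; have := deg_ge u; move: (alpha * _) => x; lra.
  rewrite lerD2r; apply: le_trans (ler_sum _ bound) _.
  rewrite (eq_bigl (mem [set w | u \in P w])) => [|w]; last by rewrite /= inE.
  rewrite sumr_const -[leLHS]mulr_natl.
  apply: le_trans (ler_wpM2r _ count) _; first by rewrite divr_ge0 ?mulr_ge0 ?ltW.
  rewrite /Ma le_eqVlt; apply/orP; left; apply/eqP.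
  have := pow0 (phi u); move: (2 ^+ phi u) => y y0.
  by field; rewrite !gt_eqF.
Qed.

End Assembly.

(** * Choice of the parameters *)

Section Numerics.

Variable R : realType.

Lemma dyadic_bounds (t : R) : 1 <= t -> exists m, 2 ^+ m <= t < 2 ^+ m.+1.
Proof.
move=> t1; have t0 : 0 <= t by lra.
have /andP[le_t lt_t] := truncn_itv t0.
have n_gt0 : (0 < Num.truncn t)%N by rewrite truncn_gt0.
have /andP[le_n lt_n] := trunc_log_bounds (isT : 1 < 2)%N n_gt0.
exists (trunc_log 2 (Num.truncn t)); rewrite -!natrX; apply/andP; split.
  by apply: le_trans le_t; rewrite ler_nat.
by apply: lt_le_trans lt_t _; rewrite ler_nat.
Qed.

Lemma expR1_ge2 : 2 <= expR 1 :> R.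
Proof. by have := expR_ge1Dx (1 : R); lra. Qed.

(* 2^m lies between 100 and 200 times sqrt(d / ln d), and 2^i0 between 320 and
   640 times ln d / alpha: labels below i0 are unused, since there the number of
   saves per vertex of A is too small to be concentrated. *)
Lemma parameters (alpha : R) (d : nat) :
    0 < alpha -> alpha <= 1 ->
    expR (24 * (40 * 100 / alpha + 250)) <= d%:R ->
  let k := `|Num.floor (alpha / 1000%:R * Num.sqrt (d%:R * ln (d%:R : R)))|%N in
  exists m i0 : nat, let Ml := (m - i0)%:R * (alpha * 2 ^+ m / 1280) : R in
  [/\ (8 * (d * d * (m.+1 * 2)))%:R <= expR (alpha * d%:R / 2 ^+ m.+1 / 4),
      (8 * d.+1)%:R <= expR (Ml / 4),
      (8 * d.+1)%:R <= expR (alpha * 2 ^+ i0 / 40 / 4),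
      2 ^+ m * 2 ^+ m <= 160 * d%:R :> R &
      [/\ 2 ^+ m <= d%:R :> R,
          k.+1%:R <= Ml / 4,
          k.+1%:R <= alpha * d%:R / 2 ^+ m / 4 &
          k%:R < alpha * d%:R / 2]].
Proof.
move=> a0 a1 large_d k.
have d0 : 0 < d%:R :> R by apply: lt_le_trans large_d; exact: expR_gt0.
set x := ln (d%:R : R); have dE : d%:R = expR x by rewrite /x lnK.
have x_ge : 24 * (40 * 100 / alpha + 250) <= x by rewrite -ler_expR -dE.
have quot0 : 0 < 40 * 100 / alpha by rewrite divr_gt0 // mulr_gt0.
have x250 : 250 <= x by lra.
(* z is d^(1/24); as ln d <= 24 z, all requirements become polynomial in z. *)
pose z := expR (x / 24); pose D := expR (x / 2); pose s := Num.sqrt x.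
have x_z : x <= 24 * z by have := expR_ge1Dx (x / 24); rewrite -/z; lra.
have z_ge : 40 * 100 / alpha + 250 <= z by have := expR_ge1Dx (x / 24); rewrite -/z; lra.
have az : 40 * 100 <= alpha * z by rewrite -ler_pdivrMl // mulrC; lra.
have z_large : 40 * 100 <= z by nra.
have s2 : s * s = x by rewrite -expr2 sqr_sqrtr //; clear -x250; lra.
have s0 : 0 <= s by exact: sqrtr_ge0.
have s15 : 15 <= s by clear -s0 s2 x250; nra.
have D0 : 0 < D by exact: expR_gt0.
have D2 : d%:R = D * D by rewrite dE -expRD; congr expR; clear; field.
have DE : D = z ^+ 2 * z ^+ 2 * z ^+ 8.
  by rewrite -!exprD -expRM_natl; congr expR; clear; field.
have z1 : 1 <= z by clear -z_large; lra.
have z2 : 1 <= z ^+ 2 by apply: exprn_ege1.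
have aD : 40 * 100 * (z ^+ 2 * z ^+ 2) <= alpha * D.
  rewrite DE [leRHS]mulrCA [leLHS]mulrC ler_wpM2l //.
    by rewrite mulr_ge0 ?exprn_ge0 ?expR_ge0.
  by apply: le_trans az _; rewrite ler_pM2l // ler_eXnr.
have s_x : s <= x by clear -s15 s2; nra.
have xx : x * x <= 24 * 24 * z ^+ 2 by rewrite expr2; nra.
have x0 : 0 <= x by lra.
clear large_d x_ge quot0 z_ge az z_large x_z.
have aD_x2 : 13 / 2 * (x * x) <= alpha * D.
  apply: le_trans aD; move: (z ^+ 2) z2 xx => y y1 le_y; clear -y1 le_y; nra.
have floorE : alpha / 1000%:R * Num.sqrt (d%:R * ln (d%:R : R)) =
    alpha * D * s / (10 * 100).
  rewrite -/x D2 sqrtrM ?mulr_ge0 ?ltW // -expr2 sqrtr_sqr gtr0_norm // -/s.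
  by clear; field.
have k_le : k%:R <= alpha * D * s / (10 * 100).
  have := floor_le (alpha * D * s / (10 * 100)); rewrite /k floorE.
  have fl0 : 0 <= Num.floor (alpha * D * s / (10 * 100)).
    by rewrite floor_ge0 divr_ge0 // mulr_ge0 // mulr_ge0 // ltW.
  by rewrite -{1}(gez0_abs fl0) pmulrn.
have aDs : 40 * 100 <= alpha * D * s by clear -aD_x2 x250 s15; nra.
have k1_le : k.+1%:R <= alpha * D * s / 800 by rewrite -natr1; clear -k_le aDs; lra.
have s_gt0 : 0 < s by clear -s15; lra.
have x_D : x <= D by clear -aD_x2 x250 a1 D0; nra.
have s15x : 15 * s <= x by clear -s15 s2; nra.
have [|m /andP[]] := @dyadic_bounds (200 * D / s).
  by rewrite ler_pdivlMr // mul1r; clear -s_x x_D D0; lra.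
have [|i0 /andP[]] := @dyadic_bounds (640 * x / alpha).
  by rewrite ler_pdivlMr // mul1r; clear -a1 x250; lra.
rewrite ler_pdivlMr // ltr_pdivrMr // => i_le i_gt.
rewrite ler_pdivlMr // ltr_pdivrMr // => m_le m_gt.
rewrite exprS in i_gt; rewrite exprS in m_gt.
have p0 : 0 < 2 ^+ m :> R by exact: exprn_gt0.
have q0 : 0 < 2 ^+ i0 :> R by exact: exprn_gt0.
have qas : 2 ^+ i0 * alpha * s <= 640 * (x * x).
  apply: le_trans (_ : 640 * x * s <= _); first by rewrite ler_wpM2r.
  by rewrite -mulrA ler_wpM2l // ler_wpM2l.
have pas : 100 * (alpha * D) <= 2 ^+ m * s * alpha.
  by rewrite mulrCA mulrC ler_wpM2r ?ltW //; clear -m_gt; lra.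
have le_i0 : (i0 <= m)%N.
  rewrite -(@ler_eXn2l R 2) ?ltr1n // -(@ler_pM2r _ (alpha * s)) ?mulr_gt0 //.
  by move: (2 ^+ m) (2 ^+ i0) qas pas => p q qas pas; clear -qas pas aD_x2 x0; nra.
have r_ge : z ^+ 2 <= 2 ^+ (m - i0).
  have pE : 2 ^+ (m - i0) * 2 ^+ i0 = 2 ^+ m :> R by rewrite -exprD subnK.
  have r0 : 0 < 2 ^+ (m - i0) :> R by exact: exprn_gt0.
  rewrite -pE in pas; move: (2 ^+ (m - i0)) (2 ^+ i0) (z ^+ 2) r0 z2 xx qas pas aD.
  move=> r q y r0 y1 xx qas pas aD; clear -r0 y1 xx qas pas aD.
  have le_r : r * (q * alpha * s) <= r * (640 * (24 * 24 * y)).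
    by rewrite ler_pM2l //; lra.
  have y0 := lt_le_trans ltr01 y1; have ry0 := mulr_gt0 r0 y0.
  by rewrite -(ler_pM2r y0); lra.
have n_ge : x / 12 <= (m - i0)%:R.
  rewrite -ler_expR; have -> : expR (x / 12) = z ^+ 2.
    by rewrite -expRM_natl; congr expR; clear; field.
  apply: le_trans r_ge _; rewrite -[(m - i0)%:R]mulr1 expRM_natl.
  by rewrite lerXn2r ?nnegrE ?expR_ge0 // expR1_ge2.
have Ml_ge : alpha * D * s / 800 <= (m - i0)%:R * (alpha * 2 ^+ m / 1280) / 4.
  apply: le_trans (_ : x / 12 * (alpha * 2 ^+ m / 1280) / 4 <= _); last first.
    rewrite ler_pM2r ?invr_gt0 // ler_wpM2r //.
    by rewrite divr_ge0 // mulr_ge0 // ltW.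
  have : 100 * (alpha * D) * s <= 2 ^+ m * s * alpha * s by rewrite ler_wpM2r.
  have -> : 2 ^+ m * s * alpha * s = 2 ^+ m * alpha * x by rewrite -s2; clear; ring.
  by move: (2 ^+ m) => p; clear -aDs; lra.
have d_ge : 250 <= d%:R :> R by rewrite D2; clear -x_D x250; nra.
have d1_le : (8 * d.+1)%:R <= expR (2 * x).
  have -> : expR (2 * x) = d%:R * d%:R by rewrite dE -expRD; congr expR; clear; field.
  by rewrite natrM -[d.+1%:R]natr1; move: (d%:R) d_ge => y y_ge; clear -y_ge; nra.
have pow_D : 15 * 2 ^+ m <= 200 * D.
  by apply: le_trans m_le; rewrite mulrC ler_pM2l.
have pow_m : 2 ^+ m <= d%:R :> R.
  by rewrite D2; move: (2 ^+ m) pow_D => p pow_D; clear -pow_D x_D x250; nra.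
exists m, i0; split; last split.
- have m1_le : m.+1%:R <= d%:R :> R.
    by apply: le_trans pow_m; rewrite -natrX ler_nat ltn_expl.
  apply: le_trans (_ : expR (4 * x) <= _).
    have -> : expR (4 * x) = d%:R * d%:R * (d%:R * d%:R).
      by rewrite dE -!expRD; congr expR; clear; field.
    rewrite !natrM; move: (m.+1%:R) (d%:R) m1_le d_ge => r y ry y_ge.
    have yy : 0 <= y * y by rewrite -expr2 sqr_ge0.
    rewrite mulrCA ler_wpM2l //; clear -ry y_ge; nra.
  rewrite ler_expR ler_pdivlMr // ler_pdivlMr ?exprn_gt0 // exprS D2.
  have : 64 * 100 * s <= alpha * D by clear -aD_x2 x250 s15x; nra.
  move/(ler_wpM2r (ltW D0)).
  have : s * (2 ^+ m * s) <= s * (200 * D) by rewrite ler_wpM2l.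
  by rewrite -s2; move: (2 ^+ m) => p; clear; lra.
- apply: le_trans d1_le _; rewrite ler_expR; apply: le_trans Ml_ge.
  have : 15 * (alpha * D) <= alpha * D * s.
    by rewrite mulrC ler_wpM2l // mulr_ge0 // ltW.
  by clear -aD_x2 x250; nra.
- apply: le_trans d1_le _; rewrite ler_expR; move: (2 ^+ i0) i_gt => q i_gt.
  by clear -i_gt; lra.
- rewrite D2; move: (2 ^+ m) p0 m_le => p p0 m_le.
  have : (p * s) * (p * s) <= (200 * D) * (200 * D).
    by rewrite ler_pM // mulr_ge0 // ltW.
  rewrite mulrACA s2; have := ler_wpM2l (mulr_ge0 (ltW p0) (ltW p0)) x250.
  by clear; lra.
- exact: pow_m.
- exact: le_trans k1_le Ml_ge.
- apply: le_trans k1_le _; rewrite ler_pdivlMr // ler_pdivlMr // D2.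
  have : alpha * D * (2 ^+ m * s) <= alpha * D * (200 * D).
    by rewrite ler_wpM2l // mulr_ge0 // ltW.
  by move: (2 ^+ m) => p; clear; lra.
- apply: le_lt_trans k_le _; rewrite D2; have : alpha * D * s <= alpha * D * D.
    by rewrite ler_wpM2l ?(le_trans s_x) // mulr_ge0 // ltW.
  by have := mulr_gt0 (mulr_gt0 a0 D0) D0; clear; lra.
Qed.

End Numerics.

Theorem theorem4p3 (R : realType) (alpha : R) :
  (0 < alpha)%R -> (alpha <= 1)%R ->
  exists d0 : nat, (1 <= d0)%N /\
    forall d : nat, (d0 <= d)%N ->
    forall (T : finType) (e : rel T),
      simple_graph e -> bipartite e -> max_degree e d ->
      (forall v, alpha * d%:R <= (deg e v)%:R)%R ->
      f_removable e (fun v => ((deg e v)%:Z -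
          Num.floor (alpha / 1000%:R * Num.sqrt (d%:R * ln (d%:R : R))))%R).
Proof.
move=> alpha_gt0 alpha_le1; pose C : R := expR (24 * (40 * 100 / alpha + 250)).
exists (Num.truncn C).+1; split=> // d le_d T e [e_sym _] [A bip] [deg_le _] deg_ge.
have large_d : C <= d%:R.
  have /andP[_ ltC] := truncn_itv (expR_ge0 (24 * (40 * 100 / alpha + 250))).
  by rewrite (le_trans (ltW ltC)) // ler_nat.
have [m [i0 [Hlab HMl Hi0 Hm2 [Hm Hk Hres Hhalf]]]] :=
  parameters alpha_gt0 alpha_le1 large_d.
have d_gt0 : (0 < d)%N by apply: leq_trans le_d.
have fl_ge0 : 0 <= Num.floor (alpha / 1000%:R * Num.sqrt (d%:R * ln (d%:R : R))).
  by rewrite floor_ge0 mulr_ge0 ?sqrtr_ge0 // divr_ge0 // ltW.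
rewrite -(gez0_abs fl_ge0).
exact: (bipartite_removable e_sym deg_le deg_ge alpha_gt0 d_gt0
  Hlab HMl Hi0 Hm2 Hm Hk Hres Hhalf bip).
Qed.
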